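(* Let $n\ge2$ and suppose that the points $$x_{n-1}\prec\cdots\prec x_1\prec v_1\prec\cdots\prec v_n\prec y_{n-1}\prec\cdots\prec y_1\prec z_{n-1}\prec\cdots\prec z_1\prec u_1\prec\cdots\prec u_n\prec x_{n-1}$$ of $\mathcal{P}\subset S^1$ are ordered anticlockwise. Let $m,l,p,m',l',p'$ be non-negative integers with $m+l+p=n$ and $m'+l'+p'=n$ (each at most $n-1$). If $l\ge l'$ or $p\le p'$, then in $\mathcal{Q}_n(\mathcal{P})$ $$\left[\Delta\big((x^m,y^l,z^p),(v^n)\big),\ \Delta\big((x^{m'},y^{l'},z^{p'}),(u^n)\big)\right]=\tfrac12\min\{m,m'\}-\tfrac12\min\{l,l'\}-\tfrac12\min\{p,p'\}.$$
   Context: **Notation.** $w^i$ denotes the sequence $w_1,\dots,w_i$ (empty for $i=0$), and $[A,B]:=\frac{\{A,B\}}{AB}$, where $\{\cdot,\cdot\}$ is the swapping bracket; $\prec$ is the cyclic anticlockwise order on $S^1$. **Swapping algebra.** Let $\mathcal{P}\subset S^1$, $\mathbb{K}$ a field of characteristic zero. An ordered pair $(x,y)$ of points of $\mathcal{P}$ is written $xy$. $\mathcal{Z}(\mathcal{P})=\mathbb{K}[\{xy\}_{x,y\in\mathcal{P}}]/(\{xx\}_{x\in\mathcal{P}})$. For $r,x,s,y\in\mathcal{P}$ choose $o\in S^1$ different from them and a homeomorphism $\sigma:S^1\setminus o\to\mathbb{R}$ compatible with the anticlockwise orientation; with $\operatorname{sgn}(a)\in\{-1,0,1\}$ the sign of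 $a$, the linking number is $$\mathcal{J}(rx,sy)=\tfrac12\operatorname{sgn}(\sigma(r)-\sigma(x))\operatorname{sgn}(\sigma(r)-\sigma(y))\operatorname{sgn}(\sigma(y)-\sigma(x))-\tfrac12\operatorname{sgn}(\sigma(r)-\sigma(x))\operatorname{sgn}(\sigma(r)-\sigma(s))\operatorname{sgn}(\sigma(s)-\sigma(x)).$$ The swapping bracket on $\mathcal{Z}(\mathcal{P})$ is $\{rx,sy\}=\mathcal{J}(rx,sy)\cdot ry\cdot sx$ on generators, extended by Leibniz's rule. Write $\Delta((x_1,\dots,x_d),(y_1,\dots,y_d))=\det(x_iy_j)_{i,j=1}^d$. $R_n(\mathcal{P})$ is the (Poisson) ideal generated by all $\Delta((x_1,\dots,x_{n+1}),(y_1,\dots,y_{n+1}))$; $\mathcal{Z}_n(\mathcal{P})=\mathcal{Z}(\mathcal{P})/R_n(\mathcal{P})$ is an integral domain with field of fractions $\mathcal{Q}_n(\mathcal{P})$, to which the bracket extends. *)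

(* Defs.v *)
From HB Require Import structures.
From mathcomp Require Import all_boot all_order all_algebra.
From mathcomp Require Import ring_quotient fraction.
From mathcomp Require Import all_classical all_reals all_analysis.
(* The notations of monalg have levels that clash with those of
   mathcomp-analysis. *)
From mathcomp Require Import -(notations) monalg.
From mathcomp Require Import ring lra.

Set Implicit Arguments.
Unset Strict Implicit.
Unset Printing Implicit Defensive.

Import Order.TTheory GRing.Theory Num.Theory.
Import numFieldNormedType.Exports numFieldTopology.Exports.

Local Open Scope classical_set_scope.
Local Open Scope ring_scope.
Local Open Scope quotient_scope.

Section Circle.
Variable R : realType.
Implicit Types a b c o : R * R.

Definition circle : set (R * R) := [set a | a.1 ^+ 2 + a.2 ^+ 2 = 1].

(* Twice the signed area of the triangle abc: for three points of the circle it
   is positive iff they are distinct and met in this order when going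
   anticlockwise from a. *)
Definition area a b c : R :=
  (b.1 - a.1) * (c.2 - a.2) - (b.2 - a.2) * (c.1 - a.1).

(* s_0 < s_1 < ... < s_k (< s_0) for the cyclic anticlockwise order *)
Definition anticlockwise (s : seq (R * R)) : Prop :=
  forall a b c, subseq [:: a; b; c] s -> 0 < area a b c.

Definition homeomorphism_to_line (U : set (R * R)) (sigma : R * R -> R) : Prop :=
  {within U, continuous sigma} /\
  exists tau : R -> R * R,
    [/\ continuous tau, forall t, U (tau t), cancel tau sigma
      & forall a, U a -> tau (sigma a) = a].

Definition compatible_with_orientation o (sigma : R * R -> R) : Prop :=
  forall a b, (circle `\ o) a -> (circle `\ o) b ->
    (sigma a < sigma b) = (0 < area o a b).

Definition is_chart o (sigma : R * R -> R) : Prop :=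
  [/\ circle o, homeomorphism_to_line (circle `\ o) sigma
    & compatible_with_orientation o sigma].

Definition stereo o a : R :=
  (o.2 * a.1 - o.1 * a.2) / (1 - (o.1 * a.1 + o.2 * a.2)).

Definition stereo_inv o (t : R) : R * R :=
  (((t ^+ 2 - 1) * o.1 + 2 * t * o.2) / (t ^+ 2 + 1),
   ((t ^+ 2 - 1) * o.2 - 2 * t * o.1) / (t ^+ 2 + 1)).

Lemma dot_lt1 o a : circle o -> (circle `\ o) a -> 0 < 1 - (o.1 * a.1 + o.2 * a.2).
Proof.
case: o a => o1 o2 [a1 a2]; rewrite /circle /= => ho [/= ha ne].
have -> : 1 - (o1 * a1 + o2 * a2) = ((o1 - a1) ^+ 2 + (o2 - a2) ^+ 2) / 2.
  by lra.
rewrite divr_gt0 // lt_def addr_ge0 ?sqr_ge0 // andbT.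
apply/negP; rewrite paddr_eq0 ?sqr_ge0 // !sqrf_eq0 !subr_eq0.
by case/andP => /eqP e1 /eqP e2; apply: ne; rewrite e1 e2.
Qed.

Lemma stereo_chart o : circle o -> is_chart o (stereo o).
Proof.
move=> ho; split => //; last first.
  move=> a b ha hb; have da := dot_lt1 ho ha; have db := dot_lt1 ho hb.
  rewrite /stereo ltr_pdivrMr // mulrAC ltr_pdivlMr // -subr_gt0.
  congr (0 < _); case: o ho {ha hb da db} => o1 o2; rewrite /circle /area /= => ho.
  have {}ho : o1 ^+ 2 = 1 - o2 ^+ 2 by lra.
  by ring: ho.
have ht (t : R) : t ^+ 2 + 1 != 0 by rewrite gt_eqF // ltr_wpDl ?sqr_ge0.
split.
  apply: continuous_in_subspaceT => a /set_mem ha.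
  have da := dot_lt1 ho ha.
  have c1 : {for a, continuous (fun x : R * R => x.1)} by exact: cvg_fst.
  have c2 : {for a, continuous (fun x : R * R => x.2)} by exact: cvg_snd.
  apply: cvgM.
    by apply: cvgB; apply: cvgM => //; exact: cvg_cst.
  apply: cvgV; first by rewrite gt_eqF.
  apply: cvgB; first exact: cvg_cst.
  by apply: cvgD; apply: cvgM => //; exact: cvg_cst.
exists (stereo_inv o); split.
- move=> t.
  have ct : t ^+ 2 @[t --> t] --> t ^+ 2 by exact: exprn_continuous.
  have cd : (t ^+ 2 + 1)^-1 @[t --> t] --> (t ^+ 2 + 1)^-1.
    by apply: cvgV; [exact: ht | apply: cvgD => //; exact: cvg_cst].
  have cn (p q : R) : (t ^+ 2 - 1) * p + 2 * t * q @[t --> t] -->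
      (t ^+ 2 - 1) * p + 2 * t * q.
    apply: cvgD; apply: cvgM; try exact: cvg_cst.
      by apply: cvgB => //; exact: cvg_cst.
    by apply: cvgM; [exact: cvg_cst | exact: cvg_id].
  refine (cvg_pair (cvgM (@cn o.1 o.2) cd) (cvgM _ cd)).
  have := @cn o.2 (- o.1).
  by rewrite mulrN; under eq_fun do rewrite mulrN.
- move=> t; split => /=.
    rewrite /circle /= in ho *.
    rewrite !expr_div_n -mulrDl; apply: canLR (mulfK _) _.
      by rewrite expf_neq0.
    have {}ho : o.1 ^+ 2 = 1 - o.2 ^+ 2 by lra.
    by ring: ho.
  move=> /(congr1 (fun a : R * R => a.1 * o.1 + a.2 * o.2)).
  rewrite /circle /= in ho; rewrite /stereo_inv /=.
  have -> : o.1 * o.1 + o.2 * o.2 = 1 by lra.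
  have -> : ((t ^+ 2 - 1) * o.1 + 2 * t * o.2) / (t ^+ 2 + 1) * o.1 +
    ((t ^+ 2 - 1) * o.2 - 2 * t * o.1) / (t ^+ 2 + 1) * o.2
    = (t ^+ 2 - 1) / (t ^+ 2 + 1).
    have {}ho : o.1 ^+ 2 = 1 - o.2 ^+ 2 by lra.
    by field: ho.
  by move/(canRL (divfK (ht t))); lra.
- move=> t; rewrite /stereo /stereo_inv /=; rewrite /circle /= in ho.
  have {}ho : o.1 ^+ 2 = 1 - o.2 ^+ 2 by lra.
  have -> : 1 - (o.1 * (((t ^+ 2 - 1) * o.1 + 2 * t * o.2) / (t ^+ 2 + 1)) +
    o.2 * (((t ^+ 2 - 1) * o.2 - 2 * t * o.1) / (t ^+ 2 + 1)))
    = 2 / (t ^+ 2 + 1) by field: ho.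
  by field: ho.
- move=> a ha; have := dot_lt1 ho ha; case: ha => ha _.
  rewrite /circle /= in ho ha; rewrite /stereo_inv /stereo.
  set d := 1 - _ => d0; set c := o.2 * _ - _.
  have e : (c / d) ^+ 2 + 1 = 2 / d.
    have -> : (c / d) ^+ 2 + 1 = (c ^+ 2 + d ^+ 2) / d ^+ 2 by field; rewrite gt_eqF.
    have -> : c ^+ 2 + d ^+ 2 = 2 * d.
      have {}ho : o.1 ^+ 2 = 1 - o.2 ^+ 2 by lra.
      have {}ha : a.1 ^+ 2 = 1 - a.2 ^+ 2 by lra.
      by rewrite /c /d; ring: ho ha.
    by field; rewrite gt_eqF.
  have e1 : (c / d) ^+ 2 - 1 = 2 / d - 2 by rewrite -e; ring.
  rewrite e e1 [a in RHS]surjective_pairing; congr (_, _).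
    have -> : ((2 / d - 2) * o.1 + 2 * (c / d) * o.2) / (2 / d)
      = (1 - d) * o.1 + c * o.2 by field; rewrite gt_eqF.
    have {}ho : o.1 ^+ 2 = 1 - o.2 ^+ 2 by lra.
    by rewrite /c /d; ring: ho.
  have -> : ((2 / d - 2) * o.2 - 2 * (c / d) * o.1) / (2 / d)
    = (1 - d) * o.2 - c * o.1 by field; rewrite gt_eqF.
  have {}ho : o.1 ^+ 2 = 1 - o.2 ^+ 2 by lra.
  by rewrite /c /d; ring: ho.
Qed.

Lemma chart_exists (r x s y : R * R) :
  exists c : (R * R) * (R * R -> R),
    c.1 \notin [:: r; x; s; y] /\ is_chart c.1 c.2.
Proof.
suff: exists2 o, o \notin [:: r; x; s; y] & circle o.
  by case=> o ho co; exists (o, stereo o); split => //; exact: stereo_chart.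
have c10 : circle (1, 0) by rewrite /circle /= expr1n expr0n addr0.
have [_ [_ [tau [_ tauc tauK _]]] _] := stereo_chart c10.
pose pts : seq (R * R) := [seq tau i%:R | i <- iota 0 5].
have upts : uniq pts.
  rewrite map_inj_uniq ?iota_uniq // => i j /(can_inj tauK)/eqP.
  by rewrite eqr_nat => /eqP.
have : ~~ all [in [:: r; x; s; y]] pts.
  by apply/negP => /allP /(uniq_leq_size upts); rewrite size_map size_iota.
case/allPn => o op o_avoids.
by exists o => //; case/mapP: op => i _ ->; have [] := tauc i%:R.
Qed.

Definition chart_avoiding (r x s y : R * R) : R * R -> R :=
  (sval (cid (chart_exists r x s y))).2.

Definition linking (K : fieldType) (r x s y : R * R) : K :=
  let sigma := chart_avoiding r x s y in
  let sgn (a : R) : K := (sgz a)%:~R in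
  2^-1 * (sgn (sigma r - sigma x) * sgn (sigma r - sigma y) * sgn (sigma y - sigma x))
  - 2^-1 * (sgn (sigma r - sigma x) * sgn (sigma r - sigma s) * sgn (sigma s - sigma x)).

End Circle.

Section GeneratedIdeal.
Variables (A : comNzRingType) (S : set A).

(* {ideal_quot I} is only defined for a proper ideal I, whence the argument S1
   below *)
Definition generated_ideal : set A :=
  [set a | exists2 cs : seq (A * A),
    (forall c, c \in cs -> S c.2) & a = \sum_(c <- cs) c.1 * c.2].

Definition generates_proper := ~ generated_ideal 1.

Definition ideal_of (_ : generates_proper) : A -> bool := fun a => `[< generated_ideal a >].

Variable S1 : generates_proper.

Lemma ideal_of_closed : idealr_closed (ideal_of S1).
Proof.
split; first by apply/asboolP; exists [::] => //; rewrite big_nil.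
  exact/asboolP.
move=> a _ _ /asboolP[cs csS ->] /asboolP[ds dsS ->]; apply/asboolP.
exists ([seq (a * c.1, c.2) | c <- cs] ++ ds).
  move=> c; rewrite mem_cat => /orP[/mapP[d dcs ->]|/dsS //].
  exact: (csS d).
rewrite big_cat big_map /= mulr_sumr; congr (_ + _).
by apply: eq_bigr => c _; rewrite mulrA.
Qed.

HB.instance Definition _ := isIdealr.Build A (ideal_of S1) ideal_of_closed.

Definition ideal : idealr A := Idealr.clone A (ideal_of S1) _.

Definition quotient_by : comNzRingType := {ideal_quot ideal}.

Definition to_quotient (a : A) : quotient_by := \pi_{ideal_quot ideal} a.

Fact to_quotient_zmod : zmod_morphism to_quotient.
Proof. exact: (pi_is_zmod_morphism {ideal_quot ideal}). Qed.

Fact to_quotient_monoid : monoid_morphism to_quotient.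
Proof. exact: (pi_is_monoid_morphism {ideal_quot ideal}). Qed.

HB.instance Definition _ :=
  GRing.isZmodMorphism.Build A quotient_by to_quotient to_quotient_zmod.
HB.instance Definition _ :=
  GRing.isMonoidMorphism.Build A quotient_by to_quotient to_quotient_monoid.

Lemma to_quotient_eq0 a : to_quotient a = 0 <-> generated_ideal a.
Proof.
rewrite -(rmorph0 to_quotient); split.
  move/eqP; rewrite /to_quotient -Quotient.idealrBE subr0.
  by rewrite unfold_in => /asboolP.
move=> ha; apply/eqP; rewrite /to_quotient -Quotient.idealrBE subr0.
by rewrite unfold_in; apply/asboolP.
Qed.

Lemma to_quotient_surj (b : quotient_by) : exists a, b = to_quotient a.
Proof. by exists (repr b); rewrite /to_quotient reprK. Qed.

Section Lift.
Variables (B : comNzRingType) (f : {rmorphism A -> B}).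
Hypothesis f0 : forall a, S a -> f a = 0.

Definition quotient_lift of forall a, S a -> f a = 0 :=
  fun b : quotient_by => f (repr b).
Local Notation lift := (quotient_lift f0).

Lemma quotient_liftE a : lift (to_quotient a) = f a.
Proof.
apply/eqP; rewrite -subr_eq0 -rmorphB; apply/eqP.
have /to_quotient_eq0[cs csS ->] :
    to_quotient (repr (to_quotient a) - a) = 0.
  by rewrite rmorphB /= [X in X - _]reprK subrr.
rewrite rmorph_sum big_seq big1 // => c /csS/f0 e.
by rewrite rmorphM e mulr0.
Qed.

Fact quotient_lift_zmod : zmod_morphism lift.
Proof.
move=> x y; have [a ->] := to_quotient_surj x; have [b ->] := to_quotient_surj y.
by rewrite -rmorphB !quotient_liftE rmorphB.
Qed.

Fact quotient_lift_monoid : monoid_morphism lift.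
Proof.
split; first by rewrite -(rmorph1 to_quotient) quotient_liftE rmorph1.
move=> x y; have [a ->] := to_quotient_surj x; have [b ->] := to_quotient_surj y.
by rewrite -rmorphM !quotient_liftE rmorphM.
Qed.

HB.instance Definition _ :=
  GRing.isZmodMorphism.Build quotient_by B lift quotient_lift_zmod.
HB.instance Definition _ :=
  GRing.isMonoidMorphism.Build quotient_by B lift quotient_lift_monoid.

End Lift.

End GeneratedIdeal.

Lemma proper_of_morphism (A B : comNzRingType) (S : set A) (f : {rmorphism A -> B}) :
  (forall a, S a -> f a = 0) -> generates_proper S.
Proof.
move=> f0 [cs csS /(congr1 f)]; rewrite rmorph1 rmorph_sum big_seq big1.
  by apply/eqP; exact: oner_neq0.
by move=> c /csS/f0 e; rewrite rmorphM e mulr0.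
Qed.

Section FractionField.
Variables (A : comNzRingType) (dom : GRing.integral_domain_axiom A).

Definition domain_of (_ : GRing.integral_domain_axiom A) : Type := A.

HB.instance Definition _ := GRing.ComNzRing.on (domain_of dom).

Let has_inverse : pred (domain_of dom) := fun a => `[< exists b, b * a = 1 >].
Let inverse (a : domain_of dom) : domain_of dom :=
  if pselect (exists b, b * a = 1) is left e then sval (cid e) else a.

Fact inverse_left : {in has_inverse, left_inverse 1 inverse *%R}.
Proof.
move=> a /asboolP ha; rewrite /inverse; case: pselect => // e.
exact: (svalP (cid e)).
Qed.

Fact has_inverse_intro a b : b * a = 1 -> has_inverse a.
Proof. by move=> ba; apply/asboolP; exists b. Qed.

Fact inverse_out : {in [predC has_inverse], inverse =1 id}.
Proof. by move=> a /asboolP ha; rewrite /inverse; case: pselect. Qed.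

HB.instance Definition _ := GRing.ComNzRing_hasMulInverse.Build (domain_of dom)
  inverse_left has_inverse_intro inverse_out.
HB.instance Definition _ :=
  GRing.ComUnitRing_isIntegral.Build (domain_of dom) dom.

Definition fraction_field : fieldType := {fraction (domain_of dom)}.

Definition to_fractions (a : A) : fraction_field :=
  FracField.tofrac (a : domain_of dom).

Fact to_fractions_zmod : zmod_morphism to_fractions.
Proof. exact: (@tofrac_is_zmod_morphism (domain_of dom)). Qed.

Fact to_fractions_monoid : monoid_morphism to_fractions.
Proof. exact: (@tofrac_is_monoid_morphism (domain_of dom)). Qed.

HB.instance Definition _ :=
  GRing.isZmodMorphism.Build A fraction_field to_fractions to_fractions_zmod.
HB.instance Definition _ :=
  GRing.isMonoidMorphism.Build A fraction_field to_fractions to_fractions_monoid.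

End FractionField.

Section SwappingAlgebra.
Variables (R : realType) (K : fieldType) (P : set (R * R)).
Implicit Types x y r s : P.

(* K[{xy}], with xy = free_pair x y *)
Definition free_algebra : comAlgType K := malg (cmonom (P * P)%type) K.

Definition free_pair x y : free_algebra := mkmalgU (ucm (x, y)) 1.

Definition diagonal : set free_algebra := [set a | exists x, a = free_pair x x].

Let constant_term : {rmorphism free_algebra -> K} := mcoeff mone.

Fact constant_term_pair x y : constant_term (free_pair x y) = 0.
Proof.
rewrite /= mcoeffU; case: eqP => // /(congr1 (@mdeg _)).
by rewrite mdegU mdeg1.
Qed.

Fact constant_term_diagonal a : diagonal a -> constant_term a = 0.
Proof. by case=> x ->; exact: constant_term_pair. Qed.

Fact diagonal_proper : generates_proper diagonal.
Proof. exact: proper_of_morphism constant_term_diagonal. Qed.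

(* Z(P), with xy = ordered_pair x y *)
Definition swapping_algebra : comNzRingType := quotient_by diagonal_proper.

Definition scalar (c : K) : swapping_algebra := to_quotient diagonal_proper c%:A.

Definition ordered_pair x y : swapping_algebra := to_quotient diagonal_proper (free_pair x y).

Definition Delta d (X Y : d.-tuple P) : swapping_algebra :=
  \det (\matrix_(i < d, j < d) ordered_pair (tnth X i) (tnth Y j)).

Definition rank_relations n : set swapping_algebra :=
  [set a | exists X Y : n.+1.-tuple P, a = Delta X Y].

Fact rank_relations_proper n : generates_proper (rank_relations n).
Proof.
pose aug : {rmorphism swapping_algebra -> K} :=
  @quotient_lift _ _ diagonal_proper _ _ constant_term_diagonal.
apply: (@proper_of_morphism _ _ _ aug) => _ [X [Y ->]].
rewrite /Delta -det_map_mx (_ : map_mx _ _ = 0) ?det0 //.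
apply/matrixP => i j; rewrite !mxE.
exact: etrans (quotient_liftE _ _ _) (constant_term_pair _ _).
Qed.

Definition rank_swapping_algebra n : comNzRingType :=
  quotient_by (@rank_relations_proper n).

Definition to_rank_algebra n (a : swapping_algebra) : rank_swapping_algebra n :=
  to_quotient (@rank_relations_proper n) a.

(* k is the structure map of the K-algebra A *)
Definition bilinear_derivation (A : comNzRingType) (k : K -> A) (br : A -> A -> A) :=
  [/\ forall c a b d, br (k c * a + b) d = k c * br a d + br b d,
      forall c a b d, br d (k c * a + b) = k c * br d a + br d b,
      forall a b d, br (a * b) d = a * br b d + br a d * b
    & forall a b d, br d (a * b) = a * br d b + br d a * b].

Definition is_swapping_bracket
    (br : swapping_algebra -> swapping_algebra -> swapping_algebra) : Prop :=
  bilinear_derivation scalar br /\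
  forall r x s y,
    br (ordered_pair r x) (ordered_pair s y)
    = scalar (linking K (val r) (val x) (val s) (val y))
      * ordered_pair r y * ordered_pair s x.

(* Z_n(P) = rank_swapping_algebra n is known to be an integral domain; dom stands
   for that fact, which the library needs in order to form the field of
   fractions Q_n(P) *)
Section Fractions.
Variables (n : nat) (dom : GRing.integral_domain_axiom (rank_swapping_algebra n)).

Definition rank_fraction_field : fieldType := fraction_field dom.

Definition to_rank_fractions (a : swapping_algebra) : rank_fraction_field :=
  to_fractions dom (to_rank_algebra n a).

(* As a bilinear biderivation of a field is determined by its values on a ring of
   which it is the field of fractions, br is the only extension of brZ *)
Definition extends_bracket
    (brZ : swapping_algebra -> swapping_algebra -> swapping_algebra)
    (br : rank_fraction_field -> rank_fraction_field -> rank_fraction_field) :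
    Prop :=
  bilinear_derivation (to_rank_fractions \o scalar) br /\
  forall a b, br (to_rank_fractions a) (to_rank_fractions b)
    = to_rank_fractions (brZ a b).

End Fractions.

Section Prefixes.
Variables (n m l p : nat).

Definition admissible : Prop :=
  [/\ m <= n.-1, l <= n.-1, p <= n.-1 & m + l + p = n]%N.

Variables (x y z : n.-1.-tuple P).

Fact prefixes_size : admissible -> size (take m x ++ take l y ++ take p z) == n.
Proof.
case=> hm hl hp e; rewrite !size_cat !size_takel ?size_tuple //.
by rewrite addnA e.
Qed.

(* (x^m, y^l, z^p) *)
Definition prefixes (h : admissible) : n.-tuple P := Tuple (prefixes_size h).

End Prefixes.

End SwappingAlgebra.

(* written [A, B] *)
Definition log_bracket (F : fieldType) (br : F -> F -> F) (A B : F) : F :=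
  br A B / (A * B).

(* Main.v *)
Require Import Defs.
From HB Require Import structures.
From mathcomp Require Import all_boot all_order all_algebra.
From mathcomp Require Import ring_quotient fraction.
From mathcomp Require Import all_classical all_reals all_analysis.
From mathcomp Require Import -(notations) monalg.
From mathcomp Require Import finmap zify ring lra.

Set Implicit Arguments.
Unset Strict Implicit.
Unset Printing Implicit Defensive.

Import Order.TTheory GRing.Theory Num.Theory.
Import numFieldNormedType.Exports.

Local Open Scope classical_set_scope.
Local Open Scope ring_scope.

(* The linking number J(a v_j, b u_l) of a chord ending in the block v with a
   chord ending in the block u does not depend on j and l.  Summing Leibniz's rule
   for the two determinants over the columns therefore gives
     {Delta(X, v), Delta(Y, u)}
       = sum_(i, k) J(X_i v, Y_k u) Delta(X[X_i := Y_k], v) Delta(Y[Y_k := X_i], u).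
   A term with X_i <> Y_k vanishes by a repeated row if Y_k is in X or X_i is in Y;
   otherwise X_i and Y_k lie in different groups among x, y, z, and the chords
   cross only if X_i is a z and Y_k a y, which forces p > p' and l < l'.  The terms
   with X_i = Y_k contribute J(a v, a u) = 1/2 for a in x, and -1/2 for a in y
   or z. *)

(** * Leibniz's rule for determinants *)

Section Derivation.
Variables (A : comNzRingType) (D : A -> A).
Hypotheses (DD : forall a b, D (a + b) = D a + D b)
  (DM : forall a b, D (a * b) = a * D b + D a * b).

Lemma derivation0 : D 0 = 0.
Proof. by apply: (addIr (D 0)); rewrite -DD !add0r. Qed.

Lemma derivation1 : D 1 = 0.
Proof.
by have := DM 1 1; rewrite !mul1r mulr1 -[LHS]add0r => /addIr.
Qed.

Lemma derivationN a : D (- a) = - D a.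
Proof. by apply: (addIr (D a)); rewrite -DD !addNr derivation0. Qed.

Lemma derivation_sum I (r : seq I) (F : I -> A) :
  D (\sum_(i <- r) F i) = \sum_(i <- r) D (F i).
Proof. exact: (big_morph D DD derivation0). Qed.

Lemma derivation_sign (b : bool) a : D ((-1) ^+ b * a) = (-1) ^+ b * D a.
Proof. by case: b; rewrite ?expr1 ?expr0 ?mulN1r ?derivationN ?mul1r. Qed.

Lemma derivation_prod n (F : 'I_n -> A) :
  D (\prod_i F i) = \sum_i \prod_k (if k == i then D (F k) else F k).
Proof.
elim: n F => [|n IHn] F; first by rewrite !big_ord0 derivation1.
rewrite big_ord_recl DM IHn [RHS]big_ord_recl addrC; congr (_ + _).
  by rewrite big_ord_recl.
rewrite mulr_sumr; apply: eq_bigr => i _; rewrite [RHS]big_ord_recl /=.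
by congr (_ * _); apply: eq_bigr => k _; rewrite (inj_eq lift_inj).
Qed.

Lemma derivation_det n (M : 'M[A]_n) :
  D (\det M) = \sum_i \sum_j D (M i j) * cofactor M i j.
Proof.
rewrite derivation_sum.
under eq_bigr do rewrite derivation_sign derivation_prod mulr_sumr.
rewrite exchange_big; apply: eq_bigr => i _ /=.
(* [Mi] is [M] with row i differentiated. Expanding it along that row brings in the cofactors of [M]
   itself, since these delete row i. *)
pose Mi := \matrix_(k, j) if k == i then D (M k j) else M k j.
transitivity (\det Mi).
  apply: eq_bigr => s _; congr (_ * _).
  by apply: eq_bigr => k _; rewrite mxE.
rewrite (expand_det_row _ i); apply: eq_bigr => j _; rewrite mxE eqxx.
congr (_ * (_ * \det _)); apply/matrixP => a b.
by rewrite !mxE eq_sym (negPf (neq_lift _ _)).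
Qed.

End Derivation.

(** * The linking number in terms of oriented areas *)

Section CircleOrder.
Variable R : realType.
Implicit Types a b c o : R * R.

Lemma area_cycle a b c : area a b c = area b c a.
Proof. rewrite /area; ring. Qed.

Lemma area_swap a b c : area a c b = - area a b c.
Proof. rewrite /area; ring. Qed.

Lemma area_repeat a b : area a b a = 0.
Proof. by rewrite /area !subrr !mulr0 subrr. Qed.

(* On the unit circle |area a b c| = |ab| |bc| |ca| / 2, while
   1 - o.1 * a.1 - o.2 * a.2 = |oa|^2 / 2. *)
Lemma area_mul3 o a b c :
  @circle R o -> @circle R a -> @circle R b -> @circle R c ->
  area o a b * area o a c * area o b c =
  2 * (1 - (o.1 * a.1 + o.2 * a.2)) * (1 - (o.1 * b.1 + o.2 * b.2))
    * (1 - (o.1 * c.1 + o.2 * c.2)) * area a b c.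
Proof.
case: o a b c => o1 o2 [a1 a2] [b1 b2] [c1 c2]; rewrite /circle /area /=.
move=> ho ha hb hc.
have {}ho : o1 ^+ 2 = 1 - o2 ^+ 2 by lra.
have {}ha : a1 ^+ 2 = 1 - a2 ^+ 2 by lra.
have {}hb : b1 ^+ 2 = 1 - b2 ^+ 2 by lra.
have {}hc : c1 ^+ 2 = 1 - c2 ^+ 2 by lra.
ring: ho ha hb hc.
Qed.

Lemma sgz_chart o (sigma : R * R -> R) a b : is_chart o sigma ->
  (@circle R `\ o) a -> (@circle R `\ o) b ->
  sgz (sigma a - sigma b) = - sgz (area o a b).
Proof.
case=> _ _ comp ha hb.
case: (ltgtP (sigma a) (sigma b)) => h.
- by rewrite ltr0_sgz ?subr_lt0 // gtr0_sgz // -comp.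
- rewrite gtr0_sgz ?subr_gt0 // ltr0_sgz ?opprK //.
  by rewrite area_swap oppr_lt0 -comp.
(* Where the chart values agree, compatibility makes neither the area nor its opposite positive. *)
- have := comp a b ha hb; have := comp b a hb ha; rewrite h ltxx subrr sgz0.
  rewrite area_swap oppr_gt0 => /esym n1 /esym n2.
  suff -> : area o a b = 0 by rewrite sgz0 oppr0.
  by apply/eqP; rewrite eq_le !leNgt n1 n2.
Qed.

(** By [sgz_chart], each product of three signs in the definition is the sign of the left side of
    [area_mul3], whose right side is a positive multiple of one area. Hence the point removed by the
    chart drops out. *)
Lemma linkingE (K : fieldType) r x s y :
  @circle R r -> @circle R x -> @circle R s -> @circle R y ->
  linking K r x s y =
  2^-1 * ((sgz (area r x y))%:~R - (sgz (area r x s))%:~R).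
Proof.
move=> cr cx cs cy; rewrite /linking /chart_avoiding.
case: (cid _) => -[c sigma] /= [avoids chart].
have [co _ _] := chart.
have dom w : w \in [:: r; x; s; y] -> @circle R w -> (@circle R `\ c) w.
  by move=> hw cw; split=> //= wo; rewrite -wo hw in avoids.
have key w : w \in [:: r; x; s; y] -> @circle R w ->
    sgz (sigma r - sigma x) * sgz (sigma r - sigma w) * sgz (sigma w - sigma x)
    = sgz (area r x w).
  move=> hw cw; have dr : (@circle R `\ c) r by apply: dom; rewrite ?inE ?eqxx.
  have dx : (@circle R `\ c) x by apply: dom; rewrite ?inE ?eqxx ?orbT.
  have dw := dom w hw cw.
  rewrite !(sgz_chart chart) // (area_swap c x w) sgzN opprK mulrNN -!sgzM.
  by rewrite area_mul3 // sgzM gtr0_sgz ?mul1r // !mulr_gt0 ?dot_lt1.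
by rewrite /= -mulrBr -!intrM /= !key ?inE ?eqxx ?orbT.
Qed.

End CircleOrder.

(** * Characters of the swapping algebra and nonvanishing of determinants *)

Section CharacteristicMorphism.
Variables (R : realType) (K : fieldType) (P : set (R * R)) (S : pred (P * P)).

(** The value of the monomial [w] when the variables in [S] are set to 1 and all others to 0. *)
Definition monomial_character (w : cmonom (P * P)%type) : K :=
  `[< forall a, w a != 0%N -> S a >]%:R.

Fact monomial_character_mmorphism : mmorphism monomial_character.
Proof.
split=> [w1 w2|]; rewrite /monomial_character.
  rewrite -natrM mulnb -asbool_and; congr ((nat_of_bool _)%:R).
  apply: asbool_equiv_eq; split=> [h|[h1 h2] a].
    by split=> a ha; apply: h; rewrite cmM addn_eq0 (negPf ha) ?andbF.
  by rewrite cmM addn_eq0 negb_and => /orP[/h1|/h2].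
by rewrite asboolT // => a; rewrite cm1.
Qed.

HB.instance Definition _ :=
  isMultiplicative.Build (cmonom (P * P)%type) K monomial_character
    monomial_character_mmorphism.

Let eval : {rmorphism free_algebra K P -> K} := mmap idfun monomial_character.

Let eval_pair a b : eval (free_pair K a b) = (S (a, b))%:R.
Proof.
rewrite /= mmapU mul1r /monomial_character; congr ((nat_of_bool _)%:R).
apply/asboolP/idP => [|Sab c].
  by apply; rewrite cmUU.
by rewrite cmU; case: (eqVneq (a, b) c) => [<-|].
Qed.

(** The evaluation of polynomials at the indicator function of [S] descends to the quotient because
    [S] avoids the diagonal, so every generator xx goes to 0. *)
Lemma pair_character : (forall a, ~~ S (a, a)) ->
  exists f : {rmorphism swapping_algebra K P -> K},
    forall a b, f (ordered_pair K a b) = (S (a, b))%:R.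
Proof.
move=> S_irr.
have f0 (a : free_algebra K P) : Defs.diagonal a -> eval a = 0.
  by case=> b ->; rewrite eval_pair (negPf (S_irr b)).
exists (@quotient_lift _ _ (@diagonal_proper R K P) _ eval f0) => a b.
exact: etrans (quotient_liftE _ _ _) (eval_pair a b).
Qed.

End CharacteristicMorphism.

(** The product factors through a space of dimension n, so its rank is less than its size. *)
Lemma det_mulmx_small (K : fieldType) n (A : 'M[K]_(n.+1, n)) (B : 'M[K]_(n, n.+1)) :
  \det (A *m B) = 0.
Proof.
apply/eqP; rewrite -[_ == 0]negbK -unitfE -unitmxE -row_free_unit /row_free.
by rewrite neq_ltn ltnS (leq_trans (mxrankM_maxl A B) (rank_leq_col A)).
Qed.

Section Nonvanishing.
Variables (R : realType) (K : fieldType) (P : set (R * R)) (n : nat)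
  (dom : GRing.integral_domain_axiom (rank_swapping_algebra K P n)).

(* The swapping algebra is sent to K by X_i V_j |-> 1 if i = j, all other pairs
   going to 0; the matrices (xy) then factor through K^n, hence their minors of
   size n+1 vanish. *)
Lemma Delta_neq0 (X V : n.-tuple P) : uniq (X ++ V) ->
  to_rank_fractions dom (Delta K X V) != 0.
Proof.
rewrite cat_uniq => /and3P[uX /hasPn XV uV].
pose S (a : P * P) := [exists i, (a.1 == tnth X i) && (a.2 == tnth V i)].
have S_irr a : ~~ S (a, a).
  apply/existsP => -[i /andP[/= /eqP-> /eqP e]].
  by have := XV _ (mem_tnth i V); rewrite -e mem_tnth.
have [f fE] := @pair_character R K P S S_irr.
have f_rank a : @rank_relations R K P n a -> f a = 0.
  case=> Y [Z ->]; rewrite /Delta -det_map_mx.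
  rewrite -[RHS](@det_mulmx_small _ _
    (\matrix_(i, k) (tnth Y i == tnth X k)%:R)
    (\matrix_(k, j) (tnth Z j == tnth V k)%:R)).
  congr (\det _); apply/matrixP => i j; rewrite !mxE [LHS]fE.
  have [/existsP[k /andP[/= ek1 ek2]]|/existsPn noS] := boolP (S _).
    rewrite (bigD1 k) //= !mxE ek1 ek2 mulr1 big1 ?addr0 // => k' k'k.
    by rewrite !mxE (eqP ek1) (inj_eq (tuple_uniqP _ uX)) eq_sym (negPf k'k) mul0r.
  rewrite big1 // => k _; rewrite !mxE -natrM mulnb.
  by rewrite (negPf (noS k)).
have fX : f (Delta K X V) = 1.
  rewrite /Delta -det_map_mx -(det1 K n).
  congr (\det _); apply/matrixP => i j; rewrite !mxE [LHS]fE.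
  congr ((nat_of_bool _)%:R); apply/existsP/idP => [[k /andP[/= ek1 ek2]]|/eqP->].
    rewrite !(inj_eq (tuple_uniqP _ _)) // in ek1 ek2.
    by rewrite (eqP ek1) (eqP ek2).
  by exists j; rewrite /= !eqxx.
rewrite /to_rank_fractions /to_fractions tofrac_eq0.
apply/eqP => /to_quotient_eq0[cs csS] /(congr1 f).
rewrite fX rmorph_sum big_seq big1; first by apply/eqP; exact: oner_neq0.
by move=> c /csS/f_rank e; rewrite rmorphM /= e mulr0.
Qed.

End Nonvanishing.

(** * The bracket of two determinants *)

(** The sum expands the determinant of [M] with row i replaced by row k, which has a repeated row
    unless k = i. This is an entry of the product of [M] with its adjugate. *)
Lemma row_cofactor (A : comNzRingType) n (M : 'M[A]_n) i k :
  \sum_j M k j * cofactor M i j = \det M *+ (k == i).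
Proof.
have /matrixP/(_ k i) := mul_mx_adj M; rewrite !mxE => <-.
by apply: eq_bigr => j _; rewrite mxE.
Qed.

Section SwappingDeterminants.
Variables (A : comNzRingType) (br : A -> A -> A).
Hypotheses (brDl : forall d a b, br (a + b) d = br a d + br b d)
  (brDr : forall d a b, br d (a + b) = br d a + br d b)
  (brMl : forall d a b, br (a * b) d = a * br b d + br a d * b)
  (brMr : forall d a b, br d (a * b) = a * br d b + br d a * b).
Variables (T : eqType) (pair : T -> T -> A) (link : T -> T -> T -> T -> A).
Hypothesis br_pair : forall r x s y,
  br (pair r x) (pair s y) = link r x s y * pair r y * pair s x.
Variable n : nat.
Implicit Types X V Y U : n.-tuple T.

Definition pair_mx X V := \matrix_(i, j) pair (tnth X i) (tnth V j).

(** Leibniz's rule in both arguments. Each swapped pair is grouped with the cofactor of the matrix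
    whose columns it meets, so that column sums become determinants with one row exchanged. *)
Lemma bracket_det X V Y U :
  br (\det (pair_mx X V)) (\det (pair_mx Y U)) =
  \sum_i \sum_j \sum_k \sum_l
    link (tnth X i) (tnth V j) (tnth Y k) (tnth U l)
    * (pair (tnth X i) (tnth U l) * cofactor (pair_mx Y U) k l)
    * (pair (tnth Y k) (tnth V j) * cofactor (pair_mx X V) i j).
Proof.
rewrite (derivation_det (brDl _) (brMl _)).
apply: eq_bigr => i _; apply: eq_bigr => j _.
rewrite (derivation_det (brDr _) (brMr _)).
rewrite mulr_suml; apply: eq_bigr => k _; rewrite mulr_suml; apply: eq_bigr => l _.
by rewrite [pair_mx X V i j]mxE [pair_mx Y U k l]mxE br_pair; ring.
Qed.

Lemma bracket_det_exchange X V Y U (w : T -> T -> A) : uniq Y ->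
  (forall a v b u, a \in X -> v \in V -> b \in Y -> u \in U -> link a v b u = w a b) ->
  (forall a b, a \in X -> b \in Y -> a \notin Y -> b \notin X -> w a b = 0) ->
  br (\det (pair_mx X V)) (\det (pair_mx Y U)) =
  (\sum_(a <- X | a \in Y) w a a) * (\det (pair_mx X V) * \det (pair_mx Y U)).
Proof.
move=> uY wE w0; rewrite bracket_det.
set M := pair_mx X V; set N := pair_mx Y U.
(* [MV k i] is the determinant of [M] after its row X_i is replaced by the row of Y_k, and [NU i k]
   that of [N] after its row Y_k is replaced by the row of X_i. *)
pose MV k i := \sum_j pair (tnth Y k) (tnth V j) * cofactor M i j.
pose NU i k := \sum_l pair (tnth X i) (tnth U l) * cofactor N k l.
have MVE k i i0 : tnth Y k = tnth X i0 -> MV k i = \det M *+ (i0 == i).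
  by move=> e; rewrite -row_cofactor; apply: eq_bigr => j _; rewrite mxE e.
have NUE k i k0 : tnth X i = tnth Y k0 -> NU i k = \det N *+ (k0 == k).
  by move=> e; rewrite -row_cofactor; apply: eq_bigr => j _; rewrite mxE e.
transitivity (\sum_i \sum_k w (tnth X i) (tnth Y k) * NU i k * MV k i).
  apply: eq_bigr => i _; rewrite exchange_big; apply: eq_bigr => k _ /=.
  rewrite mulr_sumr; apply: eq_bigr => j _.
  rewrite mulr_sumr mulr_suml; apply: eq_bigr => l _.
  by rewrite wE ?mem_tnth.
rewrite [in RHS]big_mkcond big_tuple mulr_suml; apply: eq_bigr => i _.
case: ifPn => [/tnthP[k0 e]|XiY].
  (* As X_i is already row k0 of [N], putting it in another row k repeats a row, so only k = k0
     contributes. *)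
  rewrite (bigD1 k0) //= (NUE _ _ _ e) (MVE _ _ _ (esym e)) !eqxx !mulr1n.
  rewrite -e big1 ?addr0 => [|k kk0]; last first.
    by rewrite (NUE _ _ _ e) eq_sym (negPf kk0) mulr0n mulr0 mul0r.
  by rewrite -mulrA [_ * \det M]mulrC.
rewrite mul0r big1 // => k _.
(* If Y_k is row i0 of [M], then i0 differs from i because X_i is not in Y, and a row is repeated.
   Otherwise the weight [w] vanishes. *)
have [/tnthP[i0 e]|YkX] := boolP (tnth Y k \in X).
  rewrite (MVE _ _ _ e); case: eqP => [ei|_]; last by rewrite mulr0n mulr0.
  by rewrite -ei -e mem_tnth in XiY.
by rewrite w0 ?mem_tnth // !mul0r.
Qed.

End SwappingDeterminants.

(** * Passage to the swapping algebra and to its fractions *)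

Section Scalar.
Variables (R : realType) (K : fieldType) (P : set (R * R)).

Fact scalar1 : Defs.scalar P (1 : K) = 1.
Proof. by rewrite /Defs.scalar scale1r rmorph1. Qed.

Fact scalar_zmod : zmod_morphism (@Defs.scalar R K P).
Proof. by move=> a b; rewrite /Defs.scalar scalerBl rmorphB. Qed.

Fact scalar_monoid : monoid_morphism (@Defs.scalar R K P).
Proof.
split=> [|a b]; first exact: scalar1.
by rewrite /Defs.scalar -rmorphM /= -scalerAl mul1r scalerA.
Qed.

HB.instance Definition _ :=
  GRing.isZmodMorphism.Build K (swapping_algebra K P) (@Defs.scalar R K P) scalar_zmod.
HB.instance Definition _ :=
  GRing.isMonoidMorphism.Build K (swapping_algebra K P) (@Defs.scalar R K P) scalar_monoid.

Variable brZ : swapping_algebra K P -> swapping_algebra K P -> swapping_algebra K P.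
Hypothesis brZP : is_swapping_bracket brZ.

Lemma bracket_Delta n (X V Y U : n.-tuple P) (w : P -> P -> K) : uniq Y ->
  (forall a v b u, a \in X -> v \in V -> b \in Y -> u \in U ->
    linking K (val a) (val v) (val b) (val u) = w a b) ->
  (forall a b, a \in X -> b \in Y -> a \notin Y -> b \notin X -> w a b = 0) ->
  brZ (Delta K X V) (Delta K Y U) =
  Defs.scalar P (\sum_(a <- X | a \in Y) w a a) * (Delta K X V * Delta K Y U).
Proof.
move=> uY wE w0; have [[addl addr Ml Mr] brE] := brZP.
have Dl d a b : brZ (a + b) d = brZ a d + brZ b d.
  by have := addl 1 a b d; rewrite scalar1 !mul1r.
have Dr d a b : brZ d (a + b) = brZ d a + brZ d b.
  by have := addr 1 a b d; rewrite scalar1 !mul1r.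
rewrite rmorph_sum.
have := @bracket_det_exchange _ brZ Dl Dr (fun d a b => Ml a b d)
  (fun d a b => Mr a b d) _ (@ordered_pair R K P)
  (fun r x s y => Defs.scalar P (linking K (val r) (val x) (val s) (val y)))
  brE n X V Y U (fun a b => Defs.scalar P (w a b)) uY.
apply.
  by move=> a c b d aX cV bY dU; rewrite wE.
by move=> a b aX bY aY bX; rewrite w0 // rmorph0.
Qed.

End Scalar.

Section RankFractions.
Variables (R : realType) (K : fieldType) (P : set (R * R)) (n : nat)
  (dom : GRing.integral_domain_axiom (rank_swapping_algebra K P n)).

Lemma to_rank_fractionsM a b : to_rank_fractions dom (a * b) =
  to_rank_fractions dom a * to_rank_fractions dom b.
Proof. by rewrite /to_rank_fractions /to_rank_algebra !rmorphM. Qed.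

(** Sums of linking numbers are computed in [K]. A ring morphism between fields carries them over
    together with the inverse of 2. *)
Lemma to_rank_fractions_scalar :
  exists f : {rmorphism K -> rank_fraction_field dom},
    forall c, to_rank_fractions dom (Defs.scalar P c) = f c.
Proof.
by exists (to_fractions dom \o
  (to_quotient (@rank_relations_proper R K P n) \o @Defs.scalar R K P)).
Qed.

End RankFractions.

Lemma log_bracket_eq (F : fieldType) (br : F -> F -> F) A B c :
  A != 0 -> B != 0 -> br A B = c * (A * B) -> log_bracket br A B = c.
Proof. by move=> A0 B0 e; rewrite /log_bracket e mulfK ?mulf_neq0. Qed.

(** * Subsequences, prefixes and distinctness of cyclically ordered points *)

Lemma subseq_cons_cat (T : eqType) a (s t1 t2 : seq T) :
  a \in t1 -> subseq s t2 -> subseq (a :: s) (t1 ++ t2).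
Proof. by move=> at1 st2; rewrite (cat_subseq (s1 := [:: a])) ?sub1seq. Qed.

Lemma subseq_catr (T : eqType) (s t1 t2 : seq T) :
  subseq s t2 -> subseq s (t1 ++ t2).
Proof. by move=> st2; rewrite (cat_subseq (s1 := [::])) ?sub0seq. Qed.

Lemma subseq_pair (T : eqType) (s : seq T) a b : a \in s -> b \in s ->
  [\/ a = b, subseq [:: a; b] s | subseq [:: b; a] s].
Proof.
move=> /splitPr[s1 s2]; rewrite mem_cat inE => /or3P[b1|/eqP->|b2].
- by constructor 3; rewrite (cat_subseq (s1 := [:: b])) ?sub1seq ?mem_head.
- by constructor 1.
- by constructor 2; apply: subseq_catr; rewrite /= eqxx sub1seq.
Qed.

Lemma mem_take_leq (T : eqType) (s : seq T) i j a : (i <= j)%N ->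
  a \in take i s -> a \in take j s.
Proof. by move=> /subnKC <-; rewrite takeD mem_cat => ->. Qed.

(** The source of the minima in the theorem: the shorter prefix lies in the longer one, and without
    repetitions nothing beyond it is counted. *)
Lemma count_take (T : eqType) (s : seq T) i j : uniq s -> (i <= size s)%N ->
  (j <= size s)%N -> count [in take j s] (take i s) = minn i j.
Proof.
move=> us si sj; have [ij|/ltnW ji] := leqP i j.
  rewrite -[RHS](size_takel si); apply/eqP; rewrite -all_count.
  by apply/allP => a; apply: mem_take_leq.
rewrite -(subnKC ji) takeD count_cat -[RHS]addn0.
have := us; rewrite -{1}(cat_take_drop j s) cat_uniq => /and3P[_ /hasPn out _].
congr addn; last first.
  by apply/eqP; rewrite -leqn0 leqNgt -has_count; apply/hasPn => a /mem_take /out.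
by rewrite -[RHS](size_takel sj); apply/eqP; rewrite -all_count; apply/allP.
Qed.

Lemma not_uniq_split (T : eqType) (s : seq T) : ~~ uniq s ->
  exists a s1 s2 s3, s = s1 ++ a :: s2 ++ a :: s3.
Proof.
elim: s => //= b s IHs; rewrite negb_and negbK => /orP[|/IHs[a [s1 [s2 [s3 ->]]]]].
  by case/splitPr=> s2 s3; exists b, [::], s2, s3.
by exists a, (b :: s1), s2, s3.
Qed.

(** A repeated point and any third entry would form a triple of area 0. The third entry exists by
    the bound on the length. *)
Lemma anticlockwise_uniq (R : realType) (s : seq (R * R)) :
  (2 < size s)%N -> anticlockwise s -> uniq s.
Proof.
move=> s3 h; apply/negPn/negP => /not_uniq_split[a [s1 [s2 [s' e]]]].
have sub2 : subseq [:: a; a] (a :: s2 ++ a :: s').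
  by rewrite /= eqxx sub1seq mem_cat mem_head orbT.
have [c] : exists c, [\/ subseq [:: c; a; a] s, subseq [:: a; c; a] s
    | subseq [:: a; a; c] s].
  rewrite {}e in s3 *; case: s1 s3 => [|c s1] s3.
    case: s2 {sub2} s3 => [|c s2] s3.
      case: s' s3 => [|c s'] // _; exists c; constructor 3.
      by rewrite /= !eqxx sub0seq.
    exists c; constructor 2; rewrite /= !eqxx sub1seq.
    by rewrite mem_cat mem_head orbT.
  by exists c; constructor 1; rewrite /= eqxx subseq_catr.
by case=> /h; rewrite /area ?subrr ?mul0r ?mulr0 ?subrr ?ltxx // mulrC subrr ltxx.
Qed.

(** * Linking numbers for the given arrangement of points *)

Section Configuration.
Variables (R : realType) (K : fieldType) (P : set (R * R)).
Hypothesis P_circle : P `<=` @circle R.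
Variables x v y z u : seq P.
Hypothesis ordered : anticlockwise [seq val a | a <- rev x ++ v ++ rev y ++ rev z ++ u].
Hypothesis distinct : uniq (rev x ++ v ++ rev y ++ rev z ++ u).
Let yz := rev y ++ rev z.

Lemma area_config a b c : subseq [:: a; b; c] (rev x ++ v ++ yz ++ u) ->
  0 < area (val a) (val b) (val c).
Proof. by rewrite /yz -catA => /(map_subseq val)/ordered. Qed.

Lemma area_x_v_yz a c b : a \in x -> c \in v -> b \in yz ->
  0 < area (val a) (val c) (val b).
Proof.
move=> ax cv byz; apply: area_config; apply: subseq_cons_cat; rewrite ?mem_rev //.
by apply: subseq_cons_cat => //; rewrite sub1seq mem_cat byz.
Qed.

Lemma area_x_v_u a c d : a \in x -> c \in v -> d \in u ->
  0 < area (val a) (val c) (val d).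
Proof.
move=> ax cv du; apply: area_config; apply: subseq_cons_cat; rewrite ?mem_rev //.
by apply: subseq_cons_cat => //; rewrite sub1seq mem_cat du orbT.
Qed.

Lemma area_v_yz_u c a d : c \in v -> a \in yz -> d \in u ->
  0 < area (val c) (val a) (val d).
Proof.
move=> cv ayz du; apply/area_config/subseq_catr/subseq_cons_cat => //.
by apply: subseq_cons_cat => //; rewrite sub1seq.
Qed.

Lemma area_v_y_z c a b : c \in v -> a \in y -> b \in z ->
  0 < area (val c) (val a) (val b).
Proof.
move=> cv ay bz; apply/area_config/subseq_catr/subseq_cons_cat => //.
rewrite /yz -catA; apply: subseq_cons_cat; rewrite ?mem_rev //.
by rewrite sub1seq mem_cat mem_rev bz.
Qed.

(** No point of the groups x, y, z lies inside the arc spanned by v, so all of v is on the same side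
    of a and b. *)
Lemma sgz_area_v_irrelevant a b : a \in x ++ yz -> b \in x ++ yz ->
  {in v &, forall c d,
    sgz (area (val a) (val c) (val b)) = sgz (area (val a) (val d) (val b))}.
Proof.
(* [before a b] says that, going anticlockwise from a, all of v is met ahead of b. Any two distinct
   points of the groups are comparable. *)
pose before (a b : P) := forall c, c \in v -> 0 < area (val a) (val c) (val b).
suff tri : a \in x ++ yz -> b \in x ++ yz -> [\/ a = b, before a b | before b a].
  move=> ha hb c d cv dv.
  have [->|ab|ba] := tri ha hb.
  - by rewrite !area_repeat.
  - by rewrite !gtr0_sgz ?ab.
  - by rewrite !ltr0_sgz // area_swap area_cycle oppr_lt0 ba.
have x_x p q : subseq [:: p; q] (rev x) -> before q p.
  move=> pq c cv; rewrite -area_cycle; apply: area_config.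
  by apply: (cat_subseq (s1 := [:: p; q]) (s2 := [:: c])); rewrite ?sub1seq ?mem_cat ?cv.
have yz_yz p q : subseq [:: p; q] yz -> before q p.
  move=> pq c cv; rewrite area_cycle; apply/area_config/subseq_catr/subseq_cons_cat => //.
  exact: subseq_trans pq (prefix_subseq _ _).
rewrite (mem_cat a) (mem_cat b) => /orP[ax|ayz] /orP[bx|byz].
- have [||->|/x_x|/x_x] := @subseq_pair _ (rev x) a b; rewrite ?mem_rev //.
  + by constructor 1.
  + by constructor 3.
  + by constructor 2.
- by constructor 2 => c cv; apply: area_x_v_yz.
- by constructor 3 => c cv; apply: area_x_v_yz.
- have [->|/yz_yz|/yz_yz] := subseq_pair ayz byz.
  + by constructor 1.
  + by constructor 3.
  + by constructor 2.
Qed.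

Variable v0 : P.
Hypothesis v0v : v0 \in v.

(** For a in one of the three groups, the sign of the area of a, c, d for any c in v and d in u:
    chords from v to u have x on one side, y and z on the other. *)
Definition x_sign (a : P) : int := if a \in x then 1 else -1.

(** The formula of [linkingE] with [v0] standing for all of v and [x_sign] for the term that
    involves u. *)
Definition column_free_linking (a b : P) : K :=
  2^-1 * ((x_sign a)%:~R - (sgz (area (val a) (val v0) (val b)))%:~R).

Lemma yz_notin_x a : a \in yz -> a \notin x.
Proof.
move=> ayz; apply/negP => ax; move: distinct; rewrite cat_uniq => /and3P[_ /hasPn h _].
have := h a; rewrite mem_rev ax !mem_cat.
by move: ayz; rewrite mem_cat => /orP[]->; rewrite !orbT => /(_ isT).
Qed.

Lemma linking_column_free a c b d : a \in x ++ yz -> c \in v -> b \in x ++ yz ->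
  d \in u -> linking K (val a) (val c) (val b) (val d) = column_free_linking a b.
Proof.
have circ (e : P) : @circle R (val e) by exact/P_circle/set_valP.
move=> ha cv hb du; rewrite linkingE // /column_free_linking.
rewrite (sgz_area_v_irrelevant ha hb cv v0v); congr (_ * (_%:~R - _)).
move: ha; rewrite mem_cat /x_sign => /orP[ax|ayz].
  by rewrite ax gtr0_sgz ?area_x_v_u.
rewrite (negPf (yz_notin_x ayz)) ltr0_sgz // area_cycle area_swap oppr_lt0.
exact: area_v_yz_u.
Qed.

Lemma column_free_linking_diag a : column_free_linking a a = 2^-1 * (x_sign a)%:~R.
Proof.
by rewrite /column_free_linking area_repeat sgz0 subr0.
Qed.

Lemma column_free_linking_x_yz a b : a \in x -> b \in yz -> column_free_linking a b = 0.
Proof.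
move=> ax byz; rewrite /column_free_linking /x_sign ax gtr0_sgz ?area_x_v_yz //.
by rewrite subrr mulr0.
Qed.

Lemma column_free_linking_yz_x a b : a \in yz -> b \in x -> column_free_linking a b = 0.
Proof.
move=> ayz bx; rewrite /column_free_linking /x_sign (negPf (yz_notin_x ayz)).
rewrite ltr0_sgz ?subrr ?mulr0 // area_swap area_cycle oppr_lt0.
exact: area_x_v_yz.
Qed.

(** Here y and z cease to be interchangeable: for a in z and b in y the area changes sign and the
    value is [2^-1 * (-1 - 1)]. *)
Lemma column_free_linking_y_z a b : a \in y -> b \in z -> column_free_linking a b = 0.
Proof.
move=> ay bz; rewrite /column_free_linking /x_sign.
rewrite (negPf (yz_notin_x _)) ?mem_cat ?mem_rev ?ay //.
rewrite ltr0_sgz ?subrr ?mulr0 // area_cycle area_swap oppr_lt0.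
exact: area_v_y_z.
Qed.

(** * Exchange terms and diagonal terms for two families of prefixes *)

Variables m l p m' l' p' : nat.
Hypotheses (mx : (m <= size x)%N) (ly : (l <= size y)%N) (pz : (p <= size z)%N)
  (m'x : (m' <= size x)%N) (l'y : (l' <= size y)%N) (p'z : (p' <= size z)%N).
Let X := take m x ++ take l y ++ take p z.
Let Y := take m' x ++ take l' y ++ take p' z.

Let distinctP : uniq (x ++ y ++ z ++ v ++ u).
Proof.
rewrite -(perm_uniq (s1 := rev x ++ v ++ rev y ++ rev z ++ u)) //.
by apply/permP => a; rewrite !count_cat !count_rev; clear; lia.
Qed.

Lemma prefixes_uniq_v : uniq (X ++ v).
Proof.
apply: subseq_uniq distinctP; rewrite /X -!catA; do 3!apply: cat_subseq (take_subseq _ _) _.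
exact: prefix_subseq.
Qed.

Lemma prefixes_uniq_u : uniq (Y ++ u).
Proof.
apply: subseq_uniq distinctP; rewrite /Y -!catA; do 3!apply: cat_subseq (take_subseq _ _) _.
exact: suffix_subseq.
Qed.

Lemma column_free_linking_exchange a b : (l' <= l)%N \/ (p <= p')%N ->
  a \in X -> b \in Y -> a \notin Y -> b \notin X -> column_free_linking a b = 0.
Proof.
(* Two prefixes of one list are nested, which rules out a and b in the same group. *)
have nested (s : seq P) i j e f : e \in take i s -> f \in take j s ->
    e \notin take j s -> f \in take i s.
  have [ij|/ltnW ji] := leqP i j; first by move=> /(mem_take_leq ij) ->.
  by move=> _ /(mem_take_leq ji).
have in_y i e : e \in take i y -> e \in yz.
  by move=> /mem_take ey; rewrite mem_cat mem_rev ey.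
have in_z i e : e \in take i z -> e \in yz.
  by move=> /mem_take ez; rewrite mem_cat !mem_rev ez orbT.
move=> lp; rewrite !mem_cat !negb_or => /or3P[]aX /or3P[]bY /and3P[a1 a2 a3] /and3P[b1 b2 b3].
- by rewrite (nested _ _ _ _ _ aX bY a1) in b1.
- by rewrite column_free_linking_x_yz ?(mem_take aX) ?(in_y _ _ bY).
- by rewrite column_free_linking_x_yz ?(mem_take aX) ?(in_z _ _ bY).
- by rewrite column_free_linking_yz_x ?(mem_take bY) ?(in_y _ _ aX).
- by rewrite (nested _ _ _ _ _ aX bY a2) in b2.
- by rewrite column_free_linking_y_z ?(mem_take aX) ?(mem_take bY).
- by rewrite column_free_linking_yz_x ?(mem_take bY) ?(in_z _ _ aX).
(* The case of a in z and b in y, where the linking need not vanish: l' <= l would put b in [X], and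
   p <= p' would put a in [Y]. *)
- case: lp => le; first by rewrite (mem_take_leq le bY) in b2.
  by rewrite (mem_take_leq le aX) in a3.
- by rewrite (nested _ _ _ _ _ aX bY a3) in b3.
Qed.

Lemma sum_column_free_linking :
  \sum_(a <- X | a \in Y) column_free_linking a a =
  2^-1 * (minn m m')%:R - 2^-1 * (minn l l')%:R - 2^-1 * (minn p p')%:R.
Proof.
(* The contribution of one group [s] of constant sign e. As the groups are disjoint, membership in
   [Y] reduces there to membership in the prefix of [s]. *)
have block (s : seq P) i j (e : int) : uniq s -> (i <= size s)%N -> (j <= size s)%N ->
    {in s, forall a, x_sign a = e /\ (a \in Y) = (a \in take j s)} ->
    \sum_(a <- take i s | a \in Y) column_free_linking a a
    = 2^-1 * e%:~R * (minn i j)%:R.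
  move=> us si sj h.
  transitivity (\sum_(a <- take i s | a \in take j s) 2^-1 * e%:~R : K).
    rewrite big_seq_cond [RHS]big_seq_cond; apply: eq_big => a.
      by have [/mem_take/h[_ ->]|//] := boolP (a \in take i s).
    by move=> /andP[/mem_take/h[<- _] _]; rewrite column_free_linking_diag.
  by rewrite big_const_seq iter_addr_0 count_take // mulr_natr.
have := distinctP; rewrite !cat_uniq !has_cat !negb_or.
move=> /and5P[ux /and4P[/hasPn xy /hasPn xz _ _] uy /andP[/hasPn yz' _] /and3P[uz _ _]].
have xy' := fun a h => negPf (xy a h); have xz' := fun a h => negPf (xz a h).
have zy' := fun a h => negPf (yz' a h).
have notin (s : seq P) i a : a \notin s -> (a \in take i s) = false.
  by move=> h; apply/negP => /mem_take; apply/negP.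
have e1 := @block x m m' 1 ux mx m'x.
have e2 := @block y l l' (-1) uy ly l'y.
have e3 := @block z p p' (-1) uz pz p'z.
rewrite !big_cat /= e1 ?e2 ?e3.
- by rewrite rmorph1 rmorphN1 mulr1 mulrN1 !mulNr addrA.
- move=> a az; rewrite /x_sign [_ \in x]xz' // !mem_cat.
  by rewrite (notin x) ?(notin y) ?yz' ?xz.
- move=> a ay; rewrite /x_sign [_ \in x]xy' // !mem_cat.
  rewrite (notin x) ?(notin z) ?orbF ?xy //; apply/negP => /yz'.
  by rewrite ay.
- move=> a ax; rewrite /x_sign ax !mem_cat.
  rewrite (notin y) ?(notin z) ?orbF //.
    by apply/negP => /xz; rewrite ax.
  by apply/negP => /xy; rewrite ax.
Qed.

End Configuration.

(** * The normalised bracket in the field of fractions *)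

Theorem proposition5p7 (R : realType) (K : fieldType) (K0 : [pchar K] =i pred0)
  (P : set (R * R)) (P_circle : P `<=` @circle R)
  (n : nat) (n_ge2 : (2 <= n)%N)
  (dom : GRing.integral_domain_axiom (rank_swapping_algebra K P n))
  (brZ : swapping_algebra K P -> swapping_algebra K P -> swapping_algebra K P)
  (brZP : is_swapping_bracket brZ)
  (br : rank_fraction_field dom -> rank_fraction_field dom -> rank_fraction_field dom)
  (brP : extends_bracket brZ br)
  (x y z : n.-1.-tuple P) (v u : n.-tuple P)
  (ordered : anticlockwise [seq val a | a <- rev x ++ v ++ rev y ++ rev z ++ u])
  (m l p m' l' p' : nat)
  (mlp : admissible n m l p) (mlp' : admissible n m' l' p')
  (ll'_or_pp' : (l' <= l)%N \/ (p <= p')%N) :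
  log_bracket br
    (to_rank_fractions dom (Delta K (prefixes x y z mlp) v))
    (to_rank_fractions dom (Delta K (prefixes x y z mlp') u))
  = 2^-1 * (minn m m')%:R - 2^-1 * (minn l l')%:R - 2^-1 * (minn p p')%:R.
Proof.
have [m_n l_n p_n mlp_n] := mlp; have [m'_n l'_n p'_n mlp'_n] := mlp'.
have distinct : uniq (rev x ++ v ++ rev y ++ rev z ++ u).
  apply: (map_uniq (f := val)); apply: anticlockwise_uniq ordered.
  by rewrite size_map !size_cat !size_rev !size_tuple; lia.
pose v0 := tnth v (Ordinal (ltnW n_ge2)).
have v0v : v0 \in (v : seq P) by exact: mem_tnth.
have uXv : uniq (prefixes x y z mlp ++ v) by exact: (prefixes_uniq_v distinct).
have uYu : uniq (prefixes x y z mlp' ++ u) by exact: (prefixes_uniq_u distinct).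
have uY : uniq (prefixes x y z mlp') by move: uYu; rewrite cat_uniq => /and3P[].
have sub i j k : {subset take i x ++ take j y ++ take k z <= x ++ rev y ++ rev z}.
  move=> a; rewrite !mem_cat !mem_rev.
  by case/or3P => /mem_take ->; rewrite ?orbT.
have [_ brE] := brP; have [f fE] := to_rank_fractions_scalar dom.
have -> : 2^-1 * (minn m m')%:R - 2^-1 * (minn l l')%:R - 2^-1 * (minn p p')%:R =
    f (2^-1 * (minn m m')%:R - 2^-1 * (minn l l')%:R - 2^-1 * (minn p p')%:R).
  by rewrite !rmorphB !rmorphM fmorphV !rmorph_nat.
apply: log_bracket_eq (Delta_neq0 dom uXv) (Delta_neq0 dom uYu) _.
have c_sum : \sum_(a <- prefixes x y z mlp | a \in prefixes x y z mlp')
      column_free_linking K x v0 a a =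
    2^-1 * (minn m m')%:R - 2^-1 * (minn l l')%:R - 2^-1 * (minn p p')%:R.
  by apply: (sum_column_free_linking K distinct); rewrite ?size_tuple.
rewrite -c_sum -fE -to_rank_fractionsM.
apply: (etrans _ (to_rank_fractionsM _ _ _)).
(* The identity between bracket and product already holds in the swapping algebra, before the rank
   relations are imposed. Fractions serve only for the division. *)
apply: (etrans (brE _ _) (congr1 (to_rank_fractions dom) _)).
apply: (bracket_Delta brZP) => //.
- move=> a c b d /sub aX cv /sub bY du.
  exact: (linking_column_free K P_circle ordered distinct v0v).
- move=> a b aX bY aY bX.
  exact: (column_free_linking_exchange K ordered distinct v0v ll'_or_pp' aX bY aY bX).
Qed.
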